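(* Let $M\in\{\mathbb N,\mathbb Z\}$. The underlying topological space of every sofically presented dynamical $M$-system is (effectively) automatic: it is homeomorphic to an automatic space, and finite automata defining such an automatic space can be computed from a sofic presentation of the system.
   Context: A subshift over $M$ is a closed shift-invariant subset of $\Sigma^M$, $\Sigma$ a finite alphabet; it is an SFT if it is defined by finitely many forbidden words, and sofic if it is the image of an SFT under a continuous shift-commuting map. $(\Sigma^2)^M$ is identified with $\Sigma^M\times\Sigma^M$. A dynamical $M$-system is sofically presented if it is conjugate (equivariantly homeomorphic) to $Y/Z$ for some sofic shifts $Y\subset\Sigma^M$, $Z\subset(\Sigma^2)^M$ such that $Z\cap Y^2$ is an equivalence relation on $Y$, where $Y/Z$ is the topological quotient $Y/(Z\cap Y^2)$ with the induced shift action; a sofic presentation is given by finite automata for the languages of $Y$ and $Z$. A set $Y\subset A^{\mathbb N}$ is $\omega$-automatic if it is an $\omega$-regular language (accepted by a finite automaton on infinite words). An automatic space is a topological space of the form $Y/Z$ (topological quotient) where, for some finite alphabet $A$, $Y\subset A^{\mathbb N}$ is $\omega$-automatic and $Z\subset Y^2\subset (A^2)^{\mathbb N}$ is a closed $\omega$-automatic equivalence relation on $Y$. *)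

(* Defs.v *)
From HB Require Import structures.
From mathcomp Require Import all_boot all_order all_algebra.
From mathcomp Require Import all_classical topology.

Set Implicit Arguments.
Unset Strict Implicit.
Unset Printing Implicit Defensive.

Import GRing.Theory.

Local Open Scope classical_set_scope.
Local Open Scope quotient_scope.

Section Quotients.
Context {T : topologicalType} {R : rel T}.

Definition equivalence (S : rel T) : Prop :=
  [/\ reflexive S, symmetric S & transitive S].

Definition quotient_rel (E : equivalence R) : equiv_rel T :=
  let: And3 r s t := E in EquivRel R r s t.

Definition quotient_space (E : equivalence R) : topologicalType :=
  quotient_topology {eq_quot quotient_rel E}.

Definition class_of (E : equivalence R) (x : T) : quotient_space E :=
  \pi_{eq_quot quotient_rel E} x.

End Quotients.

Definition homeomorphism (T U : topologicalType) (h : T -> U) : Prop :=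
  continuous h /\ exists g : U -> T, [/\ continuous g, cancel h g & cancel g h].

Inductive time := TimeN | TimeZ.

Definition time_monoid (M : time) : pzSemiRingType :=
  match M with TimeN => nat | TimeZ => int end.
Coercion time_monoid : time >-> GRing.PzSemiRing.type.

Notation config M A := {ptws M -> discrete_topology A}.

(* The identification of A^M x A^M with (A^2)^M. *)
Definition pairing (M : Type) (A : choiceType) (x y : config M A) :
  config M (A * A)%type := fun i => (x i, y i).

Definition pair_rel (M : Type) (A : choiceType)
    (Y : set (config M A)) (Z : set (config M (A * A)%type)) :
  rel (set_type Y) := fun y y' => `[< Z (pairing (val y) (val y')) >].
Arguments pair_rel {M A} Y Z.

Section Subshifts.
Context {M : pzSemiRingType}.

Definition translate {A : choiceType} (m : M) (x : config M A) : config M A :=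
  fun i => x (m + i)%R.

Definition subshift {A : finType} (Y : set (config M A)) : Prop :=
  closed Y /\ forall m x, Y x -> Y (translate m x).

Definition word_at {A : choiceType} (x : config M A) (m : M) (n : nat) :
  seq A := mkseq (fun i => x (m + i%:R)%R) n.

Definition language {A : finType} (Y : set (config M A)) : set (seq A) :=
  [set w | exists x m n, Y x /\ w = word_at x m n].

Definition sft {A : finType} (X : set (config M A)) : Prop :=
  subshift X /\
  exists F : seq (seq A), X = [set x | forall m n, word_at x m n \notin F].

Definition sofic {A : finType} (Y : set (config M A)) : Prop :=
  subshift Y /\
  exists (B : finType) (X : set (config M B)) (phi : config M B -> config M A),
    [/\ sft X, {within X, continuous phi},
        forall m x, X x -> phi (translate m x) = translate m (phi x)
      & Y = phi @` X].

End Subshifts.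

Record dynamical_system (M : pzSemiRingType) := DynamicalSystem {
  space :> topologicalType;
  act : M -> space -> space;
  act0 : forall x, act 0%R x = x;
  actD : forall m n x, act (m + n)%R x = act m (act n x);
  act_continuous : forall m, continuous (act m)
}.

(* X is conjugate to Y/Z, with the action m . [y] = [translate m y] on Y/Z. *)
Definition conjugate_to_sofic_quotient (M : pzSemiRingType)
    (X : dynamical_system M) (A : finType)
    (Y : set (config M A)) (Z : set (config M (A * A)%type)) : Prop :=
  [/\ sofic Y, sofic Z &
      exists (E : equivalence (pair_rel Y Z)) (h : quotient_space E -> X),
        homeomorphism h /\
        forall m (y y' : set_type Y), val y' = translate m (val y) ->
          h (class_of E y') = act m (h (class_of E y))].

Definition sofically_presented (M : pzSemiRingType) (X : dynamical_system M) :
  Prop :=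
  exists (A : finType) (Y : set (config M A)) (Z : set (config M (A * A)%type)),
    conjugate_to_sofic_quotient X Y Z.

(* A finite automaton: its states are the natural numbers that it mentions,
   and (p, a, q) is the transition from p to q that reads a. *)
Record automaton (A : Type) := Automaton {
  initial : seq nat;
  transitions : seq (nat * A * nat);
  final : seq nat
}.

Section AutomatonCountable.
Context (A : countType).

Definition automaton_tuple (a : automaton A) :=
  (initial a, transitions a, final a).

Definition tuple_automaton (t : seq nat * seq (nat * A * nat) * seq nat) :=
  Automaton t.1.1 t.1.2 t.2.

Lemma automaton_tupleK : cancel automaton_tuple tuple_automaton.
Proof. by case. Qed.

HB.instance Definition _ :=
  Countable.copy (automaton A) (can_type automaton_tupleK).

End AutomatonCountable.

Section Automata.
Context {A : finType}.
Implicit Type a : automaton A.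

Fixpoint reads a (p : nat) (w : seq A) (q : nat) : Prop :=
  if w is c :: w' then
    exists2 r, (p, c, r) \in transitions a & reads a r w' q
  else p = q.

Definition accepted_words a : set (seq A) :=
  [set w | exists p q, [/\ p \in initial a, q \in final a & reads a p w q]].

Definition buchi_language a : set (config nat A) :=
  [set x | exists r : nat -> nat,
    [/\ r 0 \in initial a,
        forall i, (r i, x i, r i.+1) \in transitions a
      & forall n, exists2 i, n <= i & r i \in final a]].

Definition omega_regular (Y : set (config nat A)) : Prop :=
  exists a : automaton A, Y = buchi_language a.

End Automata.

(* Z is closed as a subset of Y^2. *)
Definition homeomorphic_to_closed_quotient (T : topologicalType) (A : finType)
    (Y : set (config nat A)) (Z : set (config nat (A * A)%type)) : Prop :=
  [/\ forall x y, Z (pairing x y) -> Y x /\ Y y,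
      closed [set yy : set_type Y * set_type Y | pair_rel Y Z yy.1 yy.2] &
      exists (E : equivalence (pair_rel Y Z)) (h : quotient_space E -> T),
        homeomorphism h].

(* T is homeomorphic to an automatic space. *)
Definition automatic (T : topologicalType) : Prop :=
  exists (A : finType) (Y : set (config nat A))
         (Z : set (config nat (A * A)%type)),
    [/\ omega_regular Y, omega_regular Z
      & homeomorphic_to_closed_quotient T Y Z].

(* A pair of automata, for Y over the alphabet 'I_k and for Z over its square:
   read on finite words in a sofic presentation, where they recognize the
   languages of the two shifts, and as Buchi automata in an automatic one. *)
Definition presentation : countType :=
  {k : nat & (automaton 'I_k * automaton ('I_k * 'I_k))%type}.

Definition sofic_presentation (M : pzSemiRingType) (X : dynamical_system M)
    (p : presentation) : Prop :=
  exists Y Z,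
    [/\ accepted_words (tagged p).1 = language Y,
        accepted_words (tagged p).2 = language Z
      & conjugate_to_sofic_quotient X Y Z].

Definition automatic_presentation (T : topologicalType) (p : presentation) :
  Prop :=
  homeomorphic_to_closed_quotient T (buchi_language (tagged p).1)
                                    (buchi_language (tagged p).2).

(* The partial recursive functions: computes c xs y states that the code c halts
   on the arguments xs with the value y. The first argument is the one on which
   PrimRec recurses and over which Mu minimizes. *)
Inductive recfun :=
| Zero
| Succ
| Proj of nat
| Comp of recfun & seq recfun
| PrimRec of recfun & recfun
| Mu of recfun.

Inductive computes : recfun -> seq nat -> nat -> Prop :=
| computes_zero xs : computes Zero xs 0
| computes_succ x xs : computes Succ (x :: xs) x.+1
| computes_proj i xs : i < size xs -> computes (Proj i) xs (nth 0 xs i)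
| computes_comp f gs xs ys z :
    size ys = size gs ->
    (forall i, i < size gs -> computes (nth Zero gs i) xs (nth 0 ys i)) ->
    computes f ys z -> computes (Comp f gs) xs z
| computes_rec0 f g xs y :
    computes f xs y -> computes (PrimRec f g) (0 :: xs) y
| computes_recS f g n xs y z :
    computes (PrimRec f g) (n :: xs) y -> computes g [:: n, y & xs] z ->
    computes (PrimRec f g) (n.+1 :: xs) z
| computes_mu f xs n :
    (forall i, i < n -> exists y, computes f (i :: xs) y.+1) ->
    computes f (n :: xs) 0 -> computes (Mu f) xs n.

(* Inputs and outputs are encoded by pickle, which on the types used here is
   built from the explicit code CodeSeq.code of finite sequences. *)
Definition computable (T U : countType) (f : T -> U) : Prop :=
  exists c : recfun, forall x, computes c [:: pickle x] (pickle (f x)).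

(* Main.v *)
Require Import Defs.
From mathcomp Require Import all_boot all_order all_algebra.
From mathcomp Require Import all_classical topology.

Set Implicit Arguments.
Unset Strict Implicit.
Unset Printing Implicit Defensive.

Import GRing.Theory.

(** Why the theorem holds. A subshift is determined by its language, so a sofic
    shift [Y] consists of the label sequences of the [M]-indexed paths of a
    finite graph. Two sources of such graphs are needed.

    If a finite automaton accepts the language of [Y], its trimmed transition
    graph, made of the transitions that lie on a path from an initial to a final
    state, presents [Y]: finite paths of this graph read factors of words of the
    language, and [Y] is closed; conversely a point of [Y] is read on every
    finite interval by some path, and Koenig's lemma gives an infinite path
    ([path_labels_trim]). If [Y] is given as the image of an SFT under a
    continuous shift-commuting map, the map has a local rule by compactness, and
    the graph of overlapping windows of the SFT presents [Y]
    ([sofic_path_labels]).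

    Reading the positions in the order 0, -1, 1, -2, 2 and so on turns a two-sided
    configuration into a one-sided one, homeomorphically. A Buechi automaton
    recognizes the configurations obtained from the paths of a graph by storing
    the two end points of the part read so far; all its states are final
    ([buchi_language_buchi]). A product of graphs restricts [Z] to the pairs of
    points of [Y] ([path_labels_restrict]). The relation so obtained is closed,
    and the quotient does not change ([closed_quotient_of_graphs]).

    The automata are computed by comprehensions and folds over lists of
    transitions. Total functions that a recursive function computes on codes are
    closed under these operations ([effective_foldl] and its consequences). The
    constructions only compare letters, so they can be carried out on the
    numerical values of the letters, which have the same codes as the letters
    themselves ([computable_automatic_of]). *)

(** * Total recursive functions *)

(** [recursive n F]: some code computes [F] on all lists of [n] arguments. What
    [F] does on the other lists is irrelevant. *)
Definition recursive n (F : seq nat -> nat) : Prop :=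
  exists c, forall xs, size xs = n -> computes c xs (F xs).

Definition recursive1 (f : nat -> nat) := recursive 1 (fun xs => f (nth 0 xs 0)).
Definition recursive2 (f : nat -> nat -> nat) :=
  recursive 2 (fun xs => f (nth 0 xs 0) (nth 0 xs 1)).

Lemma recursive_ext n F G :
  (forall xs, size xs = n -> F xs = G xs) -> recursive n F -> recursive n G.
Proof. by move=> FG [c cP]; exists c => xs xsn; rewrite -FG //; apply: cP. Qed.

Lemma recursive_proj n i : i < n -> recursive n (fun xs => nth 0 xs i).
Proof. by move=> lt_in; exists (Proj i) => xs xsn; constructor; rewrite xsn. Qed.

Lemma recursive_drop n d i :
  d + i < n -> recursive n (fun xs => nth 0 (drop d xs) i).
Proof.
by move=> lt; apply: recursive_ext (recursive_proj lt) => xs _; rewrite nth_drop.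
Qed.

Lemma recursive_lift d n F :
  recursive n F -> recursive (d + n) (fun xs => F (drop d xs)).
Proof.
move=> [c cP]; exists (Comp c (mkseq (fun i => Proj (d + i)) n)) => xs xsn.
have sz : size (drop d xs) = n by rewrite size_drop xsn addKn.
apply: (computes_comp (ys := drop d xs)); rewrite ?size_mkseq //; last exact: cP.
move=> i lt_i; rewrite nth_mkseq // nth_drop; constructor.
by rewrite xsn ltn_add2l.
Qed.

Lemma recursive_comp1 n f G :
  recursive1 f -> recursive n G -> recursive n (fun xs => f (G xs)).
Proof.
move=> [cf cfP] [cG cGP]; exists (Comp cf [:: cG]) => xs xsn.
apply: (computes_comp (ys := [:: G xs])) => //; last exact: (cfP [:: _]).
by case=> // _; apply: cGP.
Qed.

Lemma recursive_comp2 n f G H :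
  recursive2 f -> recursive n G -> recursive n H ->
  recursive n (fun xs => f (G xs) (H xs)).
Proof.
move=> [cf cfP] [cG cGP] [cH cHP]; exists (Comp cf [:: cG; cH]) => xs xsn.
apply: (computes_comp (ys := [:: G xs; H xs])) => //; last exact: (cfP [:: _; _]).
by case=> [|[|//]] _; [apply: cGP | apply: cHP].
Qed.

Lemma recursive_succ n G : recursive n G -> recursive n (fun xs => (G xs).+1).
Proof.
by apply: (@recursive_comp1 n S); exists Succ; case=> // x xs _; constructor.
Qed.

Lemma recursive_const n k : recursive n (fun=> k).
Proof.
elim: k => [|k IHk]; last exact: (recursive_succ IHk).
by exists Zero => xs _; constructor.
Qed.

Lemma recursive_subst n F G :
  recursive n.+1 F -> recursive n G -> recursive n (fun xs => F (G xs :: xs)).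
Proof.
move=> [cF cFP] [cG cGP]; exists (Comp cF (cG :: mkseq Proj n)) => xs xsn.
apply: (computes_comp (ys := G xs :: xs)) => /=; last by apply: cFP; rewrite /= xsn.
  by rewrite size_mkseq xsn.
case=> [|i]; rewrite ?size_mkseq => lt_i /=; first exact: cGP.
by rewrite nth_mkseq //; constructor; rewrite xsn.
Qed.

Lemma recursive_rec n b s m :
  recursive n b ->
  recursive n.+2 (fun xs => s (nth 0 xs 0) (nth 0 xs 1) (drop 2 xs)) ->
  recursive n m ->
  recursive n (fun xs => nat_rect _ (b xs) (fun k z => s k z xs) (m xs)).
Proof.
move=> [cb cbP] [cs csP] mP.
pose F ys := nat_rect (fun=> nat) (b (behead ys))
  (fun k z => s k z (behead ys)) (head 0 ys).
apply: (@recursive_subst n F) => //; exists (PrimRec cb cs).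
case=> // k xs [xsn]; rewrite /F /=; elim: k => [|k IHk] /=.
  by constructor; apply: cbP.
apply: (computes_recS IHk); set z := nat_rect _ _ _ _.
by have := csP [:: k, z & xs]; rewrite /= drop0; apply; rewrite xsn.
Qed.

Lemma recursive_mu n F m :
  recursive n.+1 F ->
  (forall xs, size xs = n ->
     F (m xs :: xs) = 0 /\ forall i, i < m xs -> F (i :: xs) != 0) ->
  recursive n m.
Proof.
move=> [c cP] mP; exists (Mu c) => xs xsn; have [Fm Fi] := mP xs xsn.
constructor; last by rewrite -[X in computes _ _ X]Fm; apply: cP; rewrite /= xsn.
move=> i /Fi; rewrite -lt0n => /prednK Fi_eq; exists (F (i :: xs)).-1.
by rewrite Fi_eq; apply: cP; rewrite /= xsn.
Qed.

Lemma recursive_comp3 n f G H K :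
  recursive 3 (fun xs => f (nth 0 xs 0) (nth 0 xs 1) (nth 0 xs 2)) ->
  recursive n G -> recursive n H -> recursive n K ->
  recursive n (fun xs => f (G xs) (H xs) (K xs)).
Proof.
move=> [cf cfP] [cG cGP] [cH cHP] [cK cKP].
exists (Comp cf [:: cG; cH; cK]) => xs xsn.
apply: (computes_comp (ys := [:: G xs; H xs; K xs])) => //.
  by case=> [|[|[|//]]] _; [apply: cGP | apply: cHP | apply: cKP].
exact: (cfP [:: _; _; _]).
Qed.

(** The conditional on numbers, where 0 stands for false. *)
Definition ifn (b x y : nat) : nat := if b is _.+1 then x else y.

Lemma recursive_if n b F G :
  recursive n b -> recursive n F -> recursive n G ->
  recursive n (fun xs => ifn (b xs) (F xs) (G xs)).
Proof.
apply: recursive_comp3.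
have: recursive 3 (fun xs => nat_rect (fun=> nat) (nth 0 xs 2)
                               (fun _ _ => nth 0 xs 1) (nth 0 xs 0)).
  apply: (@recursive_rec _ _ (fun _ _ ys => nth 0 ys 1));
    [exact: recursive_proj | exact: recursive_drop | exact: recursive_proj].
by apply: recursive_ext => xs _; case: (nth 0 xs 0).
Qed.

Lemma recursive_iter n b s m :
  recursive n b -> recursive1 s -> recursive n m ->
  recursive n (fun xs => iter (m xs) s (b xs)).
Proof.
move=> bP sP mP; have := @recursive_rec n b (fun _ z _ => s z) m bP _ mP.
have h : recursive n.+2 (fun xs => s (nth 0 xs 1)).
  by apply: recursive_comp1 => //; apply: recursive_proj.
move=> /(_ h); apply: recursive_ext => xs _.
by elim: (m xs) => //= k ->.
Qed.

Lemma recursive_double : recursive1 double.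
Proof.
have: recursive 1 (fun xs => iter (nth 0 xs 0) (S \o S) 0).
  apply: recursive_iter; [exact: recursive_const | | exact: recursive_proj].
  by do 2 apply: recursive_succ; apply: recursive_proj.
by apply: recursive_ext => xs _; elim: (nth 0 xs 0) => //= k ->; rewrite doubleS.
Qed.

Lemma recursive_pred : recursive1 predn.
Proof.
have := @recursive_rec 1 (fun=> 0) (fun k _ _ => k) (fun xs => nth 0 xs 0).
move=> /(_ (recursive_const _ _) (recursive_proj _) (recursive_proj _)) /=.
by move=> /(_ isT isT); apply: recursive_ext => xs _; case: (nth 0 xs 0).
Qed.

Lemma recursive_odd : recursive1 (odd : nat -> nat).
Proof.
have: recursive 1 (fun xs => iter (nth 0 xs 0) (fun z => ifn z 0 1) 0).
  apply: recursive_iter; [exact: recursive_const | | exact: recursive_proj].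
  by apply: recursive_if; [exact: recursive_proj | |]; apply: recursive_const.
apply: recursive_ext => xs _; elim: (nth 0 xs 0) => //= k ->.
by case: (odd k).
Qed.

Lemma recursive_half : recursive1 half.
Proof.
have := @recursive_rec 1 (fun=> 0) (fun k z _ => ifn (odd k) z.+1 z)
  (fun xs => nth 0 xs 0) (recursive_const _ _) _ (recursive_proj _).
have h : recursive 3 (fun xs => ifn (odd (nth 0 xs 0)) (nth 0 xs 1).+1 (nth 0 xs 1)).
  apply: recursive_if; last exact: recursive_proj.
    by apply: (recursive_comp1 recursive_odd); apply: recursive_proj.
  by apply: recursive_succ; apply: recursive_proj.
move=> /(_ h isT); apply: recursive_ext => xs _.
elim: (nth 0 xs 0) => //= k ->; rewrite uphalf_half.
by case: (odd k).
Qed.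

Lemma recursive_eq : recursive2 (fun x y => x == y).
Proof.
have subP n F G :
    recursive n F -> recursive n G -> recursive n (fun xs => F xs - G xs).
  move=> FP GP; have := recursive_iter FP recursive_pred GP.
  apply: recursive_ext => xs _.
  by elim: (G xs) => [|k IH]; rewrite ?subn0 //= IH subnS.
pose F i j := fun xs => nth 0 xs i - nth 0 xs j.
have: recursive 2 (fun xs => ifn (F 0 1 xs) 0 (ifn (F 1 0 xs) 0 1)).
  have FP i j : i < 2 -> j < 2 -> recursive 2 (F i j).
    by move=> ? ?; apply: subP; apply: recursive_proj.
  apply: recursive_if; [exact: FP | exact: recursive_const |].
  by apply: recursive_if; [exact: FP | |]; apply: recursive_const.
apply: recursive_ext => xs _; rewrite eqn_leq /leq /F.
by case: (nth 0 xs 0 - _) => //; case: (nth 0 xs 1 - _).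
Qed.

(** The list operations on codes: every natural number is the code of exactly one
    list of natural numbers. *)
Definition consn n m := 2 ^ n * m.*2.+1.
Definition headn m := head 0 (CodeSeq.decode m).
Definition tailn m := CodeSeq.code (behead (CodeSeq.decode m)).

Lemma code_cons n s : CodeSeq.code (n :: s) = consn n (CodeSeq.code s).
Proof. by []. Qed.

Lemma headn_consn n m : headn (consn n m) = n.
Proof. by rewrite -[m]CodeSeq.decodeK -code_cons /headn CodeSeq.codeK. Qed.

Lemma tailn_consn n m : tailn (consn n m) = m.
Proof. by rewrite -[m]CodeSeq.decodeK -code_cons /tailn CodeSeq.codeK. Qed.

Variant consn_spec : nat -> Type :=
| ConsnNil : consn_spec 0
| ConsnCons n m : consn_spec (consn n m).

Lemma consnP m : consn_spec m.
Proof.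
rewrite -[m]CodeSeq.decodeK; case: (CodeSeq.decode m) => [|n s].
  exact: ConsnNil.
exact: ConsnCons.
Qed.

Lemma iter_half_consn n m i :
  i <= n -> iter i half (consn n m) = consn (n - i) m.
Proof.
elim: i => [|i IHi] lt_in; first by rewrite subn0.
rewrite /= IHi 1?ltnW // /consn -subSS subSn // expnS -mulnA mul2n.
by rewrite doubleK.
Qed.

Lemma recursive_consn : recursive2 consn.
Proof.
have: recursive 2 (fun xs => iter (nth 0 xs 0) double (nth 0 xs 1).*2.+1).
  apply: recursive_iter => //; last exact: recursive_proj.
    apply: recursive_succ; apply: (recursive_comp1 recursive_double).
    exact: recursive_proj.
  exact: recursive_double.
apply: recursive_ext => xs _; elim: (nth 0 xs 0) => [|k IHk] /=.
  by rewrite /consn mul1n.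
by rewrite IHk /consn expnS -mulnA mul2n.
Qed.

(** The head of the list coded by [m] is the exponent of 2 in [m]. *)
Lemma recursive_headn : recursive1 headn.
Proof.
apply: (@recursive_mu 1 (fun ys =>
  ifn (odd (iter (nth 0 ys 0) half (nth 0 ys 1))) 0 (ifn (nth 0 ys 1) 1 0))).
  apply: recursive_if.
  - apply: (recursive_comp1 recursive_odd); apply: recursive_iter.
    + exact: recursive_proj.
    + exact: recursive_half.
    + exact: recursive_proj.
  - exact: recursive_const.
  by apply: recursive_if; [exact: recursive_proj | |]; apply: recursive_const.
move=> xs _ /=; case: (consnP (nth 0 xs 0)) => [|n m].
  by rewrite /headn /=; split.
rewrite headn_consn; split.
  by rewrite iter_half_consn // subnn /consn mul1n /= odd_double.
move=> i lt_in; rewrite iter_half_consn 1?ltnW // {1}/consn oddM oddX.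
rewrite subn_eq0 leqNgt lt_in /=.
by have : 0 < consn n m; [rewrite muln_gt0 expn_gt0 | case: (consn n m)].
Qed.

Lemma recursive_tailn : recursive1 tailn.
Proof.
have: recursive 1 (fun xs => iter (headn (nth 0 xs 0)).+1 half (nth 0 xs 0)).
  apply: recursive_iter; [exact: recursive_proj | exact: recursive_half |].
  apply: recursive_succ; apply: (recursive_comp1 recursive_headn).
  exact: recursive_proj.
apply: recursive_ext => xs _; case: (consnP (nth 0 xs 0)) => // n m.
rewrite headn_consn tailn_consn iterS iter_half_consn // subnn /consn mul1n.
exact: (half_bit_double _ true).
Qed.

Lemma size_le_code s : size s <= CodeSeq.code s.
Proof.
elim: s => //= n s IHs.
have := leq_mul (expn_gt0 2 n) (leqnn (CodeSeq.code s).*2.+1).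
by rewrite mul1n; apply: leq_trans; rewrite ltnS (leq_trans IHs) // -addnn leq_addr.
Qed.

(** The left fold of [f] over the list coded by [l]. *)
Definition foldn (f : nat -> nat -> nat) (z l : nat) :=
  foldl f z (CodeSeq.decode l).

(** As the code of a list bounds its length, [l] steps of a recursion suffice. *)
Lemma recursive_foldn n f z l :
  recursive n.+2 (fun xs => f (drop 2 xs) (nth 0 xs 0) (nth 0 xs 1)) ->
  recursive n z -> recursive n l ->
  recursive n (fun xs => foldn (f xs) (z xs) (l xs)).
Proof.
move=> [cf cfP] zP lP.
pose s k u ys := let v := iter k tailn (l ys) in ifn v (f ys u (headn v)) u.
have sP : recursive n.+2 (fun ys => s (nth 0 ys 0) (nth 0 ys 1) (drop 2 ys)).
  have lP2 : recursive n.+2 (fun ys => l (drop 2 ys)).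
    exact: (recursive_lift 2 lP).
  have vP : recursive n.+2 (fun ys => iter (nth 0 ys 0) tailn (l (drop 2 ys))).
    by apply: recursive_iter => //; [exact: recursive_tailn | exact: recursive_proj].
  apply: recursive_if => //; last exact: recursive_proj.
  have [cv cvP] := recursive_comp1 recursive_headn vP.
  (* [f] is applied to the accumulator, the next element of the list and the
     parameters; the counter of the recursion is dropped. *)
  exists (Comp cf [:: Proj 1, cv & mkseq (fun i => Proj i.+2) n]).
  move=> [//|x [//|y xs]] sz; have [xsn] := sz.
  set w := headn _.
  apply: (computes_comp (ys := [:: y, w & xs])) => /=.
  - by rewrite size_mkseq xsn.
  - case=> [_|[_|i]]; first exact: (@computes_proj 1 [:: x, y & xs]).
      exact: cvP.
    rewrite !ltnS size_mkseq => lt_i; rewrite /= nth_mkseq //.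
    by apply: (@computes_proj i.+2 [:: x, y & xs]); rewrite /= xsn.
  by have := cfP [:: y, w & xs]; rewrite /= !drop0; apply; rewrite /= xsn.
apply: recursive_ext (recursive_rec zP sP lP) => xs _; rewrite /foldn.
have iter_tail L k : iter k tailn L = CodeSeq.code (drop k (CodeSeq.decode L)).
  elim: k => [|k IHk] /=; first by rewrite drop0 CodeSeq.decodeK.
  by rewrite IHk /tailn CodeSeq.codeK -drop1 drop_drop add1n.
have step k : nat_rect (fun=> nat) (z xs) (fun k u => s k u xs) k =
              foldl (f xs) (z xs) (take k (CodeSeq.decode (l xs))).
  elim: k => [|k IHk] /=; first by rewrite take0.
  rewrite IHk /s iter_tail.
  have [le_k|lt_k] := leqP (size (CodeSeq.decode (l xs))) k.
    by rewrite drop_oversize //= !take_oversize // ltnW.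
  rewrite (take_nth 0 lt_k) -cats1 foldl_cat /= (drop_nth 0 lt_k) code_cons.
  rewrite headn_consn.
  by have : 0 < consn (nth 0 (CodeSeq.decode (l xs)) k)
                  (CodeSeq.code (drop k.+1 (CodeSeq.decode (l xs))));
    [rewrite muln_gt0 expn_gt0 | case: consn].
rewrite step take_oversize // -{2}[l xs]CodeSeq.decodeK.
exact: size_le_code.
Qed.

(** * Effective functions on countable types *)

(** A function is effective if it is computed on codes by a total recursive
    function, total even at the numbers that are not codes; totality is what
    makes folds and conditionals, which evaluate all their arguments, easy to
    compose. *)
Definition effective (T U : countType) (f : T -> U) : Prop :=
  exists2 F, recursive1 F & forall x, F (pickle x) = pickle (f x).

Lemma effective_computable (T U : countType) (f : T -> U) :
  effective f -> computable f.
Proof. by move=> [F [c cP] FE]; exists c => x; rewrite -FE; apply: cP. Qed.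

Section Effective.
Implicit Types D T U V : countType.

Lemma effective_id T : effective (@id T).
Proof. by exists id => //; apply: recursive_proj. Qed.

Lemma effective_comp T U V (g : U -> V) (f : T -> U) :
  effective g -> effective f -> effective (fun x => g (f x)).
Proof.
move=> [G GP GE] [F FP FE]; exists (G \o F); first exact: (recursive_comp1 GP FP).
by move=> x /=; rewrite FE GE.
Qed.

Lemma effective_const T U (y : U) : effective (fun _ : T => y).
Proof. by exists (fun=> pickle y) => //; apply: recursive_const. Qed.

Lemma effective_pickle D T (f : D -> T) :
  effective f -> effective (fun x => pickle (f x)).
Proof. by move=> [F FP FE]; exists F. Qed.

Lemma effective2 D T U V (g : T -> U -> V) G (f : D -> T) (h : D -> U) :
  recursive2 G -> (forall x y, G (pickle x) (pickle y) = pickle (g x y)) ->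
  effective f -> effective h -> effective (fun x => g (f x) (h x)).
Proof.
move=> GP GE [F FP FE] [H HP HE]; exists (fun n => G (F n) (H n)).
  exact: recursive_comp2.
by move=> x; rewrite FE HE GE.
Qed.

Lemma effective_cons D T (f : D -> T) (g : D -> seq T) :
  effective f -> effective g -> effective (fun x => f x :: g x).
Proof. exact: (effective2 recursive_consn). Qed.

Lemma effective_pair D T U (f : D -> T) (g : D -> U) :
  effective f -> effective g -> effective (fun x => (f x, g x)).
Proof.
apply: (@effective2 _ _ _ _ pair (fun m n => consn m (consn n 0))) => //.
apply: (recursive_comp2 recursive_consn); first exact: recursive_proj.
apply: (recursive_comp2 recursive_consn); first exact: recursive_proj.
exact: recursive_const.
Qed.

Lemma effective_fst D T U (f : D -> T * U) :
  effective f -> effective (fun x => (f x).1).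
Proof.
apply: (@effective_comp _ _ _ fst); exists headn; first exact: recursive_headn.
by move=> x; apply: headn_consn.
Qed.

Lemma effective_snd D T U (f : D -> T * U) :
  effective f -> effective (fun x => (f x).2).
Proof.
apply: (@effective_comp _ _ _ snd); exists (fun n => headn (tailn n)).
  exact: (recursive_comp1 recursive_headn recursive_tailn).
move=> x; rewrite [pickle x]/(consn _ (consn _ _)) tailn_consn.
exact: headn_consn.
Qed.

Lemma effective_comp2 D T U V (g : T -> U -> V) (f : D -> T) (h : D -> U) :
  effective (fun p : T * U => g p.1 p.2) -> effective f -> effective h ->
  effective (fun x => g (f x) (h x)).
Proof. by move=> gP fP hP; apply: (effective_comp gP (effective_pair fP hP)). Qed.

Lemma effective_eq D T (f g : D -> T) :
  effective f -> effective g -> effective (fun x => f x == g x).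
Proof.
apply: (effective2 recursive_eq) => x y.
by rewrite (inj_eq (pcan_inj pickleK)).
Qed.

Lemma effective_if D T (b : D -> bool) (f g : D -> T) :
  effective b -> effective f -> effective g ->
  effective (fun x => if b x then f x else g x).
Proof.
move=> [B BP BE] [F FP FE] [G GP GE]; exists (fun n => ifn (B n) (F n) (G n)).
  exact: recursive_if.
by move=> x; rewrite BE FE GE; case: (b x).
Qed.

Lemma effective_andb D (b c : D -> bool) :
  effective b -> effective c -> effective (fun x => b x && c x).
Proof. by move=> bP cP; apply: effective_if => //; apply: effective_const. Qed.

Lemma effective_orb D (b c : D -> bool) :
  effective b -> effective c -> effective (fun x => b x || c x).
Proof. by move=> bP cP; apply: effective_if => //; apply: effective_const. Qed.

Lemma effective_foldl D T U (f : D -> U -> T -> U) (z : D -> U) (l : D -> seq T) :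
  effective (fun p : D * (U * T) => f p.1 p.2.1 p.2.2) ->
  effective z -> effective l ->
  effective (fun x => foldl (f x) (z x) (l x)).
Proof.
move=> [F FP FE] [Z ZP ZE] [L LP LE].
pose pairn m n := consn m (consn n 0).
exists (fun n => foldn (fun u v => F (pairn n (pairn u v))) (Z n) (L n)).
  have pairP n G H : recursive n G -> recursive n H ->
      recursive n (fun xs => pairn (G xs) (H xs)).
    move=> GP HP; apply: (recursive_comp2 recursive_consn) => //.
    by apply: (recursive_comp2 recursive_consn) => //; apply: recursive_const.
  pose G xs u v := F (pairn (nth 0 xs 0) (pairn u v)).
  apply: (@recursive_foldn _ G) => //.
  apply: (recursive_comp1 FP); apply: (@pairP); first exact: recursive_drop.
  by apply: (@pairP); apply: recursive_proj.
move=> x; rewrite ZE LE /foldn CodeSeq.codeK; elim: (l x) (z x) => //= v s IHs u.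
by rewrite -IHs -(FE (x, (u, v))).
Qed.

Lemma effective_rev D T (l : D -> seq T) :
  effective l -> effective (fun x => rev (l x)).
Proof.
move=> lP; suff revE x : foldl (fun u v => v :: u) [::] (l x) = rev (l x).
  have : effective (fun x => foldl (fun u v => v :: u) [::] (l x)).
    apply: (@effective_foldl _ _ _ (fun _ u v => v :: u)) => //.
      by apply: effective_cons; [apply: effective_snd | apply: effective_fst];
        apply: effective_snd; apply: effective_id.
    exact: effective_const.
  by move=> [F FP FE]; exists F => // y; rewrite -revE.
by rewrite -[in LHS](revK (l x)) foldl_rev; elim: (rev _) => //= v s ->.
Qed.

Lemma effective_foldr D T U (f : D -> T -> U -> U) (z : D -> U) (l : D -> seq T) :
  effective (fun p : D * (T * U) => f p.1 p.2.1 p.2.2) ->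
  effective z -> effective l ->
  effective (fun x => foldr (f x) (z x) (l x)).
Proof.
move=> fP zP lP.
have : effective (fun x => foldl (fun u v => f x v u) (z x) (rev (l x))).
  apply: (@effective_foldl _ _ _ (fun x u v => f x v u)) => //;
    last exact: effective_rev.
  apply: (effective_comp (f := fun p : D * (U * T) => (p.1, (p.2.2, p.2.1))) fP).
  apply: effective_pair; first by apply: effective_fst; apply: effective_id.
  by apply: effective_pair; [apply: effective_snd | apply: effective_fst];
    apply: effective_snd; apply: effective_id.
by move=> [F FP FE]; exists F => // x; rewrite FE foldl_rev.
Qed.

Lemma effective_ext D T (f g : D -> T) : f =1 g -> effective f -> effective g.
Proof. by move=> fg [F FP FE]; exists F => // x; rewrite -fg. Qed.

(* The arguments of the function folded over a list. *)
Lemma effective_env D T : effective (fun p : D * T => p.1).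
Proof. exact/effective_fst/effective_id. Qed.

Lemma effective_arg D T : effective (fun p : D * T => p.2).
Proof. exact/effective_snd/effective_id. Qed.

Lemma effective_cat D T (f g : D -> seq T) :
  effective f -> effective g -> effective (fun x => f x ++ g x).
Proof.
move=> fP gP; apply: (@effective_ext _ _ (fun x => foldr cons (g x) (f x))).
  by move=> x; elim: (f x) => //= v s ->.
apply: (@effective_foldr _ _ _ (fun=> cons)) => //.
by apply: effective_cons; [apply: effective_fst | apply: effective_snd];
  apply: effective_arg.
Qed.

Lemma effective_flatmap D T U (f : D -> T -> seq U) (l : D -> seq T) :
  effective (fun p : D * T => f p.1 p.2) -> effective l ->
  effective (fun x => flatten [seq f x v | v <- l x]).
Proof.
move=> fP lP.
apply: (@effective_ext _ _ (fun x => foldr (fun v s => f x v ++ s) [::] (l x))).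
  by move=> x; elim: (l x) => //= v s ->.
apply: (@effective_foldr _ _ _ (fun x v s => f x v ++ s)) => //.
  apply: effective_cat; last by apply/effective_snd/effective_arg.
  apply: (effective_comp (f := fun p : D * (T * seq U) => (p.1, p.2.1)) fP).
  by apply: effective_pair;
    [exact: effective_env | apply/effective_fst/effective_arg].
exact: effective_const.
Qed.

Lemma effective_map D T U (f : D -> T -> U) (l : D -> seq T) :
  effective (fun p : D * T => f p.1 p.2) -> effective l ->
  effective (fun x => [seq f x v | v <- l x]).
Proof.
move=> fP lP.
apply: (@effective_ext _ _ (fun x => flatten [seq [:: f x v] | v <- l x])).
  by move=> x; elim: (l x) => //= v s ->.
apply: (@effective_flatmap _ _ _ (fun x v => [:: f x v])) => //.
by apply: effective_cons => //; apply: effective_const.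
Qed.

Lemma effective_filter D T (b : D -> T -> bool) (l : D -> seq T) :
  effective (fun p : D * T => b p.1 p.2) -> effective l ->
  effective (fun x => [seq v <- l x | b x v]).
Proof.
move=> bP lP.
apply: (@effective_ext _ _
  (fun x => flatten [seq if b x v then [:: v] else [::] | v <- l x])).
  by move=> x; elim: (l x) => //= v s ->; case: (b x v).
apply: (@effective_flatmap _ _ _ (fun x v => if b x v then [:: v] else [::])) => //.
apply: effective_if => //; last exact: effective_const.
by apply: effective_cons; [exact: effective_arg | exact: effective_const].
Qed.

Lemma effective_mem D T (f : D -> T) (l : D -> seq T) :
  effective f -> effective l -> effective (fun x => f x \in l x).
Proof.
move=> fP lP.
apply: (@effective_ext _ _
  (fun x => foldr (fun v b => (f x == v) || b) false (l x))).
  by move=> x; elim: (l x) => //= v s ->; rewrite in_cons.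
apply: (@effective_foldr _ _ _ (fun x v b => (f x == v) || b)) => //.
  apply: effective_orb; last by apply/effective_snd/effective_arg.
  apply: effective_eq; last by apply/effective_fst/effective_arg.
  exact: (effective_comp fP (@effective_env _ _)).
exact: effective_const.
Qed.

End Effective.

(** * Finite labelled graphs and the constructions on them *)

(** A finite graph with vertices in [nat] and edges labelled in [A], given by
    its edges (source, label, target), in the format of the transitions of an
    automaton. *)
Notation graph A := (seq (nat * A * nat)).

Section Graphs.
Context {A : Type}.
Implicit Type G : graph A.

(** The end points of the edges; isolated vertices play no role. *)
Definition vertices G : seq nat := [seq t.1.1 | t <- G] ++ [seq t.2 | t <- G].

(** The vertices that can be reached from [S] along the arrows [E]; as many
    rounds as there are arrows suffice. *)
Definition reach (E : seq (nat * nat)) (S : seq nat) : seq nat :=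
  foldr (fun _ R => R ++ [seq e.2 | e <- E & e.1 \in R]) S E.

(** The transitions that occur in some successful computation of [a]. *)
Definition trim (a : automaton A) : graph A :=
  [seq t <- transitions a |
    (t.1.1 \in reach [seq (t.1.1, t.2) | t <- transitions a] (initial a)) &&
    (t.2 \in reach [seq (t.2, t.1.1) | t <- transitions a] (final a))].

(** The graph that reads a two-sided path of [G] from the origin outwards, in the
    order of the positions 0, -1, 1, -2, 2, and so on. Its vertex [(p, q, b)]
    records the right end [p] and the left end [q] of the part read so far; the
    next letter extends this part to the right if [b] is false, and to the left
    if [b] is true. *)
Definition fold_graph G : graph A :=
  flatten [seq [seq (pickle (t.1.1, q, false), t.1.2, pickle (t.2, q, true))
               | q <- vertices G] | t <- G] ++
  flatten [seq [seq (pickle (p, t.2, true), t.1.2, pickle (p, t.1.1, false))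
               | p <- vertices G] | t <- G].

(** A Buechi automaton that reads the labels of the [M]-indexed paths of [G] from
    the origin outwards. All the states of its runs are final. *)
Definition buchi (M : time) G : automaton A :=
  match M with
  | TimeN => Automaton (vertices G) G (vertices G)
  | TimeZ => Automaton [seq pickle (p, p, false) | p <- vertices G]
               (fold_graph G) (vertices (fold_graph G))
  end.

End Graphs.

(** The product graph, whose paths carry the label of a path of [G] such that
    both components of this label are labels of paths of [H]. *)
Definition restrict_graph (A : eqType) (G : graph (A * A)) (H : graph A) :
    graph (A * A) :=
  flatten [seq flatten [seq
    [seq (pickle (t.1.1, u.1.1, v.1.1), t.1.2, pickle (t.2, u.2, v.2))
    | v <- [seq v <- H | v.1.2 == t.1.2.2]]
    | u <- [seq u <- H | u.1.2 == t.1.2.1]] | t <- G].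

(** The automata for an automatic presentation of the quotient of the subshift
    with language accepted by [ab.1] by the one with language accepted by
    [ab.2]. *)
Definition automatic_automata (M : time) (A : eqType)
    (ab : automaton A * automaton (A * A)) : automaton A * automaton (A * A) :=
  (buchi M (trim ab.1), buchi M (restrict_graph (trim ab.2) (trim ab.1))).

(** * Computability of the constructions *)

Section EffectiveGraphs.
Context {D A : countType}.
Implicit Type a : D -> automaton A.

Lemma effective_automaton (i : D -> seq nat) (t : D -> graph A) (f : D -> seq nat) :
  effective i -> effective t -> effective f ->
  effective (fun x => Automaton (i x) (t x) (f x)).
Proof.
move=> iP tP fP.
by have [F FP FE] := effective_pair (effective_pair iP tP) fP; exists F.
Qed.

Lemma effective_tuple a : effective a -> effective (fun x => automaton_tuple (a x)).
Proof. by move=> [F FP FE]; exists F. Qed.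

Lemma effective_initial a : effective a -> effective (fun x => initial (a x)).
Proof. by move=> /effective_tuple/effective_fst/effective_fst. Qed.

Lemma effective_transitions a :
  effective a -> effective (fun x => transitions (a x)).
Proof. by move=> /effective_tuple/effective_fst/effective_snd. Qed.

Lemma effective_final a : effective a -> effective (fun x => final (a x)).
Proof. by move=> /effective_tuple/effective_snd. Qed.

End EffectiveGraphs.

(* Proves that an explicit combination of effective functions is effective; the
   hint database [effective] lists the defined functions that may occur. *)
Ltac effective :=
  cbv beta; lazymatch goal with
  | |- effective (fun x => x) => apply: effective_id
  | |- effective (fun x => fst _) => apply: effective_fst; effective
  | |- effective (fun x => snd _) => apply: effective_snd; effective
  | |- effective (fun x => pair _ _) => apply: effective_pair; effective
  | |- effective (fun x => pickle _) => apply: effective_pickle; effective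
  | |- effective (fun x => initial _) => apply: effective_initial; effective
  | |- effective (fun x => transitions _) => apply: effective_transitions; effective
  | |- effective (fun x => final _) => apply: effective_final; effective
  | |- effective (fun x => Automaton _ _ _) => apply: effective_automaton; effective
  | |- effective (fun x => _ == _) => apply: effective_eq; effective
  | |- effective (fun x => _ && _) => apply: effective_andb; effective
  | |- effective (fun x => _ \in _) => apply: effective_mem; effective
  | |- effective (fun x => _ ++ _) => apply: effective_cat; effective
  | |- effective (fun x => [seq @?f x v | v <- @?l x]) =>
      apply: (@effective_map _ _ _ f l); effective
  | |- effective (fun x => [seq v <- @?l x | @?b x v]) =>
      apply: (@effective_filter _ _ b l); effective
  | |- effective (fun x => flatten [seq @?f x v | v <- @?l x]) =>
      apply: (@effective_flatmap _ _ _ f l); effective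
  | |- effective (fun x => foldr (@?f x) (@?z x) (@?l x)) =>
      apply: (@effective_foldr _ _ _ f z l); effective
  | |- effective (fun _ => ?y) => apply: effective_const
  | |- effective (fun x => ?g (@?a x) (@?b x)) =>
      first [ apply: (@effective_comp2 _ _ _ _ g a b);
              [solve [auto with effective] | effective | effective]
            | apply: (@effective_comp _ _ _ (g _) b);
              [solve [auto with effective] | effective] ]
  | |- effective (fun _ => _) => fail
  | |- effective ?g => change (effective (fun x => g x)); effective
  end.

Section EffectiveConstructions.
Context {A : countType}.

Lemma effective_vertices : effective (fun G : graph A => vertices G).
Proof. by rewrite /vertices; effective. Qed.

Lemma effective_reach : effective (fun p => reach p.1 p.2).
Proof. by rewrite /reach; effective. Qed.

#[local] Hint Resolve effective_vertices effective_reach : effective.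

Lemma effective_trim : effective (fun a : automaton A => trim a).
Proof. by rewrite /trim; effective. Qed.

Lemma effective_fold_graph : effective (fun G : graph A => fold_graph G).
Proof. by rewrite /fold_graph; effective. Qed.

#[local] Hint Resolve effective_fold_graph : effective.

Lemma effective_buchi M : effective (fun G : graph A => buchi M G).
Proof. by case: M; rewrite /buchi; effective. Qed.

Lemma effective_restrict_graph :
  effective (fun p : graph (A * A) * graph A => restrict_graph p.1 p.2).
Proof. by rewrite /restrict_graph; effective. Qed.

End EffectiveConstructions.

#[local] Hint Resolve effective_trim effective_buchi : effective.
#[local] Hint Resolve effective_restrict_graph : effective.

Lemma effective_automatic_automata M (A : countType) :
  effective (fun ab : automaton A * automaton (A * A) => automatic_automata M ab).
Proof.
rewrite /automatic_automata.
by effective.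
Qed.

(** The constructions do not look inside the letters, so that they commute with
    an injective change of alphabet. *)
Definition relabel (A B : Type) (g : A -> B) (G : graph A) : graph B :=
  [seq (t.1.1, g t.1.2, t.2) | t <- G].

Definition map_automaton (A B : Type) (g : A -> B) (a : automaton A) : automaton B :=
  Automaton (initial a) (relabel g (transitions a)) (final a).

Definition map_pair (A B : Type) (g : A -> B) (x : A * A) : B * B := (g x.1, g x.2).

Section Relabel.
Context {A B : eqType} (g : A -> B).

Lemma vertices_relabel (G : graph A) : vertices (relabel g G) = vertices G.
Proof. by rewrite /vertices -!map_comp. Qed.

Lemma trim_relabel (a : automaton A) : trim (map_automaton g a) = relabel g (trim a).
Proof.
rewrite /trim /relabel filter_map /= -!map_comp; congr map.
Qed.

Lemma map_flatmap (T U : Type) (h : T -> U) (V : Type) (f : V -> seq T) s :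
  map h (flatten [seq f x | x <- s]) = flatten [seq map h (f x) | x <- s].
Proof. by rewrite map_flatten -map_comp. Qed.

Lemma flatmap_map (T U V : Type) (h : T -> U) (f : U -> seq V) s :
  flatten [seq f x | x <- map h s] = flatten [seq f (h x) | x <- s].
Proof. by rewrite -map_comp. Qed.

Lemma fold_graph_relabel (G : graph A) :
  fold_graph (relabel g G) = relabel g (fold_graph G).
Proof.
rewrite /fold_graph vertices_relabel /relabel map_cat !map_flatmap !flatmap_map.
by congr (flatten _ ++ flatten _); apply: eq_map => t; rewrite -map_comp.
Qed.

Lemma buchi_relabel M (G : graph A) :
  buchi M (relabel g G) = map_automaton g (buchi M G).
Proof.
by case: M; rewrite /buchi /map_automaton /= ?fold_graph_relabel ?vertices_relabel.
Qed.

Lemma restrict_graph_relabel (G : graph (A * A)) (H : graph A) :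
  injective g ->
  restrict_graph (relabel (map_pair g) G) (relabel g H) =
  relabel (map_pair g) (restrict_graph G H).
Proof.
move=> g_inj; rewrite /restrict_graph /relabel map_flatmap flatmap_map.
congr flatten; apply: eq_map => t; rewrite !filter_map map_flatmap flatmap_map.
have filterE x : [seq u <- H | preim (fun u => (u.1.1, g u.1.2, u.2))
    (fun u : nat * B * nat => u.1.2 == g x) u] = [seq u <- H | u.1.2 == x].
  by apply: eq_filter => u /=; rewrite (inj_eq g_inj).
rewrite !filterE; congr flatten; apply: eq_map => u.
by rewrite -!map_comp.
Qed.

End Relabel.

Definition map_automata (A B : Type) (g : A -> B)
    (ab : automaton A * automaton (A * A)) : automaton B * automaton (B * B) :=
  (map_automaton g ab.1, map_automaton (map_pair g) ab.2).

Lemma automatic_automata_relabel (A B : eqType) (g : A -> B) M ab :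
  injective g ->
  automatic_automata M (map_automata g ab) =
  map_automata g (automatic_automata M ab).
Proof.
move=> g_inj; rewrite /automatic_automata /map_automata /= !trim_relabel.
by rewrite restrict_graph_relabel // !buchi_relabel.
Qed.

(** The function from sofic to automatic presentations; it keeps the alphabet. *)
Definition automatic_of (M : time) (p : presentation) : presentation :=
  Tagged _ (automatic_automata M (tagged p)).

Lemma pickle_map_automaton (A B : countType) (g : A -> B) (a : automaton A) :
  (forall x, pickle (g x) = pickle x) -> pickle (map_automaton g a) = pickle a.
Proof.
move=> gE.
have pickle_triple (i f : seq nat) (T : countType) (t : graph T) :
    pickle (Automaton i t f) = CodeSeq.code
      [:: CodeSeq.code [:: CodeSeq.code i; pickle t]; CodeSeq.code f].
  by rewrite -{2}(map_id i) -{2}(map_id f).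
case: a => i t f; rewrite /map_automaton !pickle_triple /=.
suff -> : pickle (relabel g t) = pickle t by [].
rewrite [LHS]/(CodeSeq.code _) -map_comp; congr CodeSeq.code.
apply: eq_map => -[[p x] q] /=.
by rewrite [LHS]/(CodeSeq.code [:: CodeSeq.code [:: p; pickle (g x)]; q]) gE.
Qed.

(** The letters of a presentation are coded by their numerical values, so that a
    presentation has the same code as its image over the alphabet [nat]. *)
Lemma computable_automatic_of M : computable (automatic_of M).
Proof.
pose raw (p : presentation) : nat * (automaton nat * automaton (nat * nat)) :=
  (tag p, map_automata val (tagged p)).
have pickle_raw p : pickle (raw p) = pickle p.
  case: p => k [a b]; rewrite /raw /map_automata /=.
  rewrite [LHS]/(CodeSeq.code [:: k; CodeSeq.code
    [:: pickle (map_automaton _ _); pickle (map_automaton _ _)]]).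
  by rewrite !pickle_map_automaton.
have raw_automatic p :
    raw (automatic_of M p) = ((raw p).1, automatic_automata M (raw p).2).
  by rewrite /raw /= automatic_automata_relabel //; apply: val_inj.
have [c cP] : computable (fun p : nat * (automaton nat * automaton (nat * nat)) =>
    (p.1, automatic_automata M p.2)).
  have automataP := effective_automatic_automata M nat.
  apply: effective_computable; effective.
exists c => p; rewrite -pickle_raw -[pickle (automatic_of M p)]pickle_raw.
by rewrite raw_automatic; apply: cP.
Qed.

(** * Reachability and the trimmed graph *)

Lemma reachP (E : seq (nat * nat)) S v :
  reflect (exists2 u, u \in S &
             exists2 p, path (fun x y => (x, y) \in E) u p & last u p = v)
          (v \in reach E S).
Proof.
have roundsP (l : seq (nat * nat)) w :
    (w \in foldr (fun _ R => R ++ [seq e.2 | e <- E & e.1 \in R]) S l) <->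
    exists2 u, u \in S & exists2 p, path (fun x y => (x, y) \in E) u p &
      last u p = w /\ size p <= size l.
  elim: l w => [|x l IHl] w /=.
    split=> [wS|[u uS [[|y p] // _ [<-]]] //]; exists w => //.
    by exists [::].
  rewrite mem_cat; split.
    case/orP => [/IHl[u uS [p up [<- le_p]]]|].
      by exists u => //; exists p => //; split=> //; apply: leq_trans le_p _.
    case/mapP => -[y z]; rewrite mem_filter /=.
    move=> /andP[/IHl[u uS [p up [py le_p]]] yz ->].
    exists u => //; exists (rcons p z); first by rewrite rcons_path up /= py.
    by rewrite last_rcons size_rcons.
  case=> u uS [p]; elim/last_ind: p => [|p z _].
    move=> _ [<- _]; apply/orP; left; apply/IHl; exists u => //.
    by exists [::].
  rewrite rcons_path last_rcons size_rcons => /andP[up pz] [<- le_p].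
  apply/orP; right; apply/mapP; exists (last u p, z) => //.
  rewrite mem_filter /= pz andbT; apply/IHl; exists u => //.
  by exists p.
apply: (iffP idP) => [/roundsP[u uS [p up [<- _]]]|[u uS [p up <-]]].
  by exists u => //; exists p.
(* A path without repeated vertices is not longer than the list of arrows. *)
apply/roundsP; exists u => //.
case/shortenP: up => q uq uniq_q _; exists q => //; split=> //.
have /andP[_ /uniq_leq_size uniq_le] := uniq_q.
rewrite -(size_map snd E); apply: uniq_le => y.
elim: q u uq {uniq_q uS} => //= z q IHq u /andP[uz zq].
rewrite inE => /orP[/eqP->|]; last exact: IHq zq.
by apply/mapP; exists (u, z).
Qed.

Lemma sub_reach E S v : v \in S -> v \in reach E S.
Proof. by move=> vS; apply/reachP; exists v => //; exists [::]. Qed.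

Lemma reach_step E S u v : u \in reach E S -> (u, v) \in E -> v \in reach E S.
Proof.
move=> /reachP[w wS [p wp pu]] uv; apply/reachP; exists w => //.
by exists (rcons p v); rewrite ?last_rcons // rcons_path wp pu.
Qed.

Section Trim.
Context {A : finType} (a : automaton A).

Lemma reads_cat p w1 w2 q :
  reads a p (w1 ++ w2) q <-> exists2 r, reads a p w1 r & reads a r w2 q.
Proof.
elim: w1 p => [|c w1 IH] p /=; first by split=> [|[_ <-]//]; exists p.
split=> [[r pr /IH[s rs sq]]|[s [r pr rs] sq]].
  by exists s => //; exists r.
by exists r => //; apply/IH; exists s.
Qed.

Lemma reads_mkseq p (x : nat -> A) n q :
  reads a p (mkseq x n) q <->
  exists r : nat -> nat, [/\ r 0 = p, r n = q &
    forall i, i < n -> (r i, x i, r i.+1) \in transitions a].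
Proof.
elim: n q => [|n IHn] q; first by split=> [<-|[r [<- <-]]] //; exists (fun=> p).
rewrite mkseqS -cats1 reads_cat; split.
  case=> s /IHn[r [r0 rn rP]] /= [q' sq' <-].
  exists (fun i => if i <= n then r i else q').
  split=> //; first by rewrite ltnn.
  move=> i; rewrite ltnS => le_in; rewrite le_in.
  case: ltngtP le_in => // [lt_in|->] _.
    exact: rP.
  by rewrite rn.
case=> r [r0 rn rP]; exists (r n); last by exists q => //; rewrite -rn; apply: rP.
by apply/IHn; exists r; split=> // i lt_in; apply: rP; rewrite ltnW.
Qed.

Lemma reach_initial q :
  q \in reach [seq (t.1.1, t.2) | t <- transitions a] (initial a) ->
  exists p w, p \in initial a /\ reads a p w q.
Proof.
move=> /reachP[p p_in [s ps <-]].
elim/last_ind: s ps => [|s q' IHs]; first by exists p, [::].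
rewrite rcons_path last_rcons => /andP[/IHs[p' [w [p'_in p'w]]]].
move=> /mapP[[[u c] v] t_in /= [sE ->]]; exists p', (w ++ [:: c]); split=> //.
by apply/reads_cat; exists u; [rewrite -sE | exists v].
Qed.

Lemma reach_final p :
  p \in reach [seq (t.2, t.1.1) | t <- transitions a] (final a) ->
  exists q w, q \in final a /\ reads a p w q.
Proof.
move=> /reachP[q q_in [s qs <-]].
have [w] : exists w, reads a q w q by exists [::].
elim: s {1 2 4}q qs w => [|p' s IHs] u /= qs w uq; first by exists q, w.
case/andP: qs => /mapP[[[x c] y] t_in /= [uE p'E]] xs.
by apply: (IHs _ xs (c :: w)); exists y; [rewrite p'E | rewrite -uE].
Qed.

(** A path of the trimmed graph reads a factor of an accepted word. *)
Lemma trim_accepted x r n :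
  (forall i, i <= n -> (r i, x i, r i.+1) \in trim a) ->
  exists u v, accepted_words a (u ++ mkseq x n.+1 ++ v).
Proof.
move=> rP; have := rP 0 isT; have := rP n (leqnn n).
rewrite !mem_filter => /andP[/andP[_ /reach_final[q [v [q_in vq]]]] _].
move=> /andP[/andP[/reach_initial[p [u [p_in pu]]] _] _].
exists u, v, p, q; split=> //; apply/reads_cat; exists (r 0) => //.
apply/reads_cat; exists (r n.+1) => //; apply/reads_mkseq; exists r; split=> // i.
by rewrite ltnS => /rP; rewrite mem_filter => /andP[].
Qed.

Lemma accepted_trim x n :
  accepted_words a (mkseq x n) ->
  exists r, forall i, i < n -> (r i, x i, r i.+1) \in trim a.
Proof.
move=> [p [q [p_in q_in /reads_mkseq[r [r0 rn rP]]]]]; exists r => i lt_in.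
rewrite mem_filter rP // andbT /=; apply/andP; split.
  elim: i lt_in => [|i IHi] lt_in; first by rewrite r0; apply: sub_reach.
  apply: (reach_step (IHi (ltnW lt_in))).
  by apply/mapP; exists (r i, x i, r i.+1) => //; apply: rP; apply: ltnW.
have final_reach k : k <= n ->
    r (n - k) \in reach [seq (t.2, t.1.1) | t <- transitions a] (final a).
  elim: k => [|k IHk] lt_kn; first by rewrite subn0 rn; apply: sub_reach.
  apply: (reach_step (IHk (ltnW lt_kn))).
  apply/mapP; exists (r (n - k.+1), x (n - k.+1), r (n - k)) => //.
  by rewrite -(subnSK lt_kn); apply: rP; rewrite ltn_subrL /= (leq_trans _ lt_kn).
have := final_reach (n - i.+1) (leq_subr _ _).
by rewrite subKn.
Qed.

End Trim.

(** * Configurations: the time monoids, cylinders and compactness *)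

Local Open Scope classical_set_scope.

Implicit Type M : time.

(** The order in which the positions of a configuration are read from the
    origin outwards: 0, 1, 2, and so on, or 0, -1, 1, -2, 2, and so on. *)
Definition position (M : time) : nat -> M :=
  match M with
  | TimeN => id
  | TimeZ => fun n => if odd n then Negz n./2 else Posz n./2
  end.

(** The inverse of [position]. *)
Definition rank (M : time) : M -> nat :=
  match M with
  | TimeN => id
  | TimeZ => fun i => match i with Posz n => n.*2 | Negz n => n.*2.+1 end
  end.
Arguments position M n : clear implicits.

Lemma rankK M : cancel (@rank M) (position M).
Proof.
case: M => [|] //= -[n|n] /=; first by rewrite odd_double doubleK.
by rewrite odd_double /= uphalf_double.
Qed.

Lemma positionK M : cancel (position M) (@rank M).
Proof.
case: M => [|] //= n; have nE := odd_double_half n.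
by case: odd nE => /= nE; rewrite -[RHS]nE.
Qed.

(** A left inverse of the map from [nat] to [M]; its values at the negative
    integers do not matter. *)
Definition offset (M : time) : M -> nat :=
  match M with TimeN => id | TimeZ => absz end.

Lemma offset_nat (M : time) n : offset (n%:R : M)%R = n.
Proof. by case: M; rewrite /= ?natn ?intz ?natz. Qed.

(** The first [n] positions lie in an interval that starts at an element [o]
    with an opposite, so that the interval can be translated to the origin. *)
Lemma position_interval (M : time) n :
  exists (o o' : M) (N : nat), (o' + o = 0)%R /\
    forall k, k < n -> exists2 j, j < N & position M k = (o + j%:R)%R.
Proof.
case: M => [|].
  exists 0%R, 0%R, n; split; first exact: addr0.
  by move=> k lt_kn; exists k; rewrite //= add0r natn.
exists (- n%:R)%R, n%:R%R, n.*2; split=> [|k lt_kn] /=; first exact: subrr.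
have lt_half : k./2 < n.
  rewrite (leq_ltn_trans _ lt_kn) // -{2}[k]odd_double_half -addnn addnA.
  exact: leq_addl.
case: ifP => _.
  exists (n - k./2.+1).
    rewrite (leq_ltn_trans (leq_subr _ _)) // -addnn -{1}[n]addn0 ltn_add2l.
    exact: leq_ltn_trans lt_kn.
  by rewrite NegzE !natz -subzn // addrA addNr add0r.
exists (n + k./2); first by rewrite -addnn ltn_add2l.
by rewrite !natz PoszD addrA addNr add0r.
Qed.

(** Two configurations agree on the first [n] positions. *)
Definition agree (M : time) (A : Type) n (x y : M -> A) : Prop :=
  forall k, k < n -> x (position M k) = y (position M k).

Lemma agreeW M A m n (x y : M -> A) : m <= n -> agree n x y -> agree m x y.
Proof. by move=> le_mn xy k lt_km; apply: xy; apply: leq_trans le_mn. Qed.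

Lemma agree_position M A n (x y : M -> A) i : agree n x y -> rank i < n -> x i = y i.
Proof. by move=> xy /xy; rewrite rankK. Qed.

Lemma nbhs_agree M (A : choiceType) (x : config M A) (U : set (config M A)) :
  nbhs x U <-> exists n, forall y, agree n x y -> U y.
Proof.
have nbhsF : Filter (nbhs x) by exact: nbhs_filter.
split; last first.
  case=> n nU; apply: filterS nU _; elim: n => [|n IHn].
    by apply: filterS filterT => y _ k; rewrite ltn0.
  have xn : nbhs x [set y : config M A | y (position M n) = x (position M n)].
    exact: (@proj_continuous _ (fun=> discrete_topology A) (position M n) x _
      (discrete_set1 _)).
  apply: filterS (filterI xn IHn) => y [yn xy] k.
  by rewrite ltnS leq_eqVlt => /orP[/eqP->|/xy//]; apply: esym.
pose F := filter_from [set: nat] (fun n => [set y : config M A | agree n x y]).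
have FF : Filter F.
  apply: filter_from_filter; first by exists 0.
  move=> m n _ _; exists (maxn m n) => // y xy; split.
    exact: agreeW (leq_maxl _ _) xy.
  exact: agreeW (leq_maxr _ _) xy.
suff : F --> x by move=> /[apply] -[n _ nU]; exists n.
apply/cvg_sup => i U' [V] [[W] oW <-] Wx WU.
exists (rank i).+1 => // y /agree_position xy; apply: WU => /=.
by rewrite -xy.
Qed.

Lemma closed_agree M (A : choiceType) (Y : set (config M A)) :
  closed Y <-> forall x, (forall n, exists2 y, Y y & agree n x y) -> Y x.
Proof.
split=> [Yc x xY|Yc x xY]; apply: Yc => //.
  move=> U /nbhs_agree[n nU]; have [y Yy xy] := xY n; exists y; split=> //.
  exact: nU.
move=> n; have /xY[y [Yy xy]] : nbhs x [set y | agree n x y].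
  by apply/nbhs_agree; exists n.
by exists y.
Qed.

(** Sequential compactness of the sequences with values in a finite set. *)
Lemma seq_compact (Q : eqType) (s : seq Q) (f : nat -> nat -> Q) :
  (forall m i, f m i \in s) ->
  exists g : nat -> Q, forall n, exists2 m, n <= m & forall i, i < n -> f m i = g i.
Proof.
move=> fs; pose q0 := f 0 0.
(* A prefix is good if infinitely many of the sequences start with it; a good
   prefix has a good extension by one letter. *)
pose good p :=
  forall n, exists2 m, n <= m & forall i, i < size p -> f m i = nth q0 p i.
have /choice[h hP] (p : seq Q) : exists q, good p -> good (rcons p q).
  have [p_good|] := pselect (good p); last by exists q0.
  suff [q qP] : exists q, good (rcons p q) by exists q.
  apply: contrapT => /forallNP no_q.
  have /choice[b bP] q : exists b, forall m,
      (forall i, i < (size p).+1 -> f m i = nth q0 (rcons p q) i) -> m < b.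
    have /existsNP[b bP] := no_q q; exists b => m mP.
    rewrite ltnNge; apply/negP => le_bm; apply: bP.
    by exists m; rewrite // size_rcons.
  have [m le_m mP] := p_good (\max_(q <- s) b q).
  have: m < b (f m (size p)).
    apply: bP => i; rewrite ltnS leq_eqVlt nth_rcons => /orP[/eqP->|lt_i].
      by rewrite ltnn eqxx.
    by rewrite lt_i mP.
  by rewrite ltnNge (leq_trans _ le_m) // leq_bigmax_seq.
pose p n := iter n (fun p => rcons p (h p)) [::].
have size_p n : size (p n) = n by elim: n => //= n IHn; rewrite size_rcons IHn.
have p_good n : good (p n).
  by elim: n => [|n IHn]; [move=> n; exists n | apply: hP].
have nth_p n i : i < n -> nth q0 (p n) i = h (p i).
  elim: n => // n IHn; rewrite ltnS leq_eqVlt /= nth_rcons size_p.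
  case/orP => [/eqP->|lt_in].
    by rewrite ltnn eqxx.
  by rewrite lt_in IHn.
exists (fun i => h (p i)) => n; have [m le_nm mP] := p_good n n.
by exists m => // i lt_in; rewrite mP ?size_p // nth_p.
Qed.

(** * Label sequences of infinite paths *)

(** The label sequences of the paths of [G] indexed by the whole of [M]. *)
Definition path_labels (M : time) (A : choiceType) (G : graph A) :
    set (config M A) :=
  [set y | exists r : M -> nat, forall i, (r i, y i, r (i + 1)%R) \in G].
Arguments path_labels M {A} G.

Lemma mem_vertices (A : eqType) (G : graph A) p c q :
  (p, c, q) \in G -> p \in vertices G /\ q \in vertices G.
Proof.
move=> G_e; rewrite /vertices !mem_cat.
split; apply/orP; [left | right]; apply/mapP; by exists (p, c, q).
Qed.

(** If every finite part of [y] is read along some path, then so is [y]. *)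
Lemma path_labels_compact M (A : choiceType) (G : graph A) (y : config M A) :
  (forall n, exists r : M -> nat, forall k, k < n ->
     let i := position M k in (r i, y i, r (i + 1)%R) \in G) ->
  path_labels M G y.
Proof.
move=> /choice[r rP].
(* The vertices that are not constrained by [rP] are replaced by 0, so that all
   of them range over a finite set. *)
pose V := 0 :: vertices G.
pose f m k := if r m (position M k) \in V then r m (position M k) else 0.
have fV m k : f m k \in V by rewrite /f; case: ifP.
have [g gP] := seq_compact fV; exists (fun i => g (rank i)) => i.
have [m le_m mP] := gP (maxn (rank i) (rank (i + 1)%R)).+1.
have := rP m (rank i); rewrite rankK => /(_ (leq_trans _ le_m)) /=.
rewrite ltnS leq_maxl => /(_ isT) edge; have [iV i1V] := mem_vertices edge.
rewrite -!mP ?ltnS ?leq_maxl ?leq_maxr // /f !rankK /V !inE iV i1V.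
by rewrite !orbT.
Qed.

(** The trimmed graph of an automaton that accepts the language of a subshift
    presents this subshift. *)
Lemma path_labels_trim M (A : finType) (Y : set (config M A)) (a : automaton A) :
  subshift Y -> accepted_words a = language Y -> path_labels M (trim a) = Y.
Proof.
move=> [Yclosed Yshift] aY; rewrite eqEsubset; split=> y.
  case=> r rP; apply: (proj1 (closed_agree Y) Yclosed) => n.
  have [o [o' [N [o'o oN]]]] := position_interval M n.
  pose z (j : nat) := y (o + j%:R)%R.
  have [u [v]] : exists u v, accepted_words a (u ++ mkseq z N.+1 ++ v).
    apply: (@trim_accepted _ _ _ (fun j => r (o + j%:R)%R)) => j _.
    by rewrite -natr1 addrA.
  rewrite aY => -[x [m [L [Yx wE]]]].
  (* This translation moves the occurrence of the factor in [x] to [o]. *)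
  exists (translate (m + (size u)%:R + o')%R x); first exact: Yshift.
  move=> k /oN[j lt_jN ->]; rewrite /translate -!addrA [(o' + _)%R]addrA o'o.
  rewrite add0r -natrD.
  have lt_uj : size u + j < L.
    rewrite -(size_mkseq (fun i => x (m + i%:R)%R) L) -[mkseq _ L]wE.
    by rewrite !size_cat size_mkseq ltn_add2l ltn_addr // ltnW.
  rewrite -[RHS](nth_mkseq (y (o + j%:R)%R) (fun i => x (m + i%:R)%R) lt_uj).
  rewrite -[mkseq _ L]wE nth_cat ltnNge leq_addr addKn nth_cat size_mkseq.
  rewrite ltnS ltnW //.
  by rewrite nth_mkseq // ltnS ltnW.
move=> Yy; apply: path_labels_compact => n.
have [o [o' [N [o'o oN]]]] := position_interval M n.
have : accepted_words a (mkseq (fun j => y (o + j%:R)%R) N).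
  by rewrite aY; exists y, o, N.
move=> /accepted_trim[r rP]; exists (fun i => r (offset (o' + i)%R)).
move=> k /oN[j lt_jN ->].
by rewrite /= -addrA natr1 !addrA o'o !add0r !offset_nat; apply: rP.
Qed.

Lemma mem_restrict_graph (A : eqType) (G : graph (A * A)) (H : graph A) e :
  reflect (exists p q p1 q1 p2 q2 c d,
    [/\ e = (pickle (p, p1, p2), (c, d), pickle (q, q1, q2)),
        (p, (c, d), q) \in G, (p1, c, q1) \in H & (p2, d, q2) \in H])
  (e \in restrict_graph G H).
Proof.
apply: (iffP flatten_mapP) => [[[[p [c d]] q] Ge /flatten_mapP[[[p1 c1] q1]]]|].
  rewrite mem_filter /= => /andP[/eqP-> He1] /mapP[[[p2 d2] q2]].
  rewrite mem_filter /= => /andP[/eqP-> He2] ->.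
  by exists p, q, p1, q1, p2, q2, c, d.
move=> [p [q [p1 [q1 [p2 [q2 [c [d [-> Ge He1 He2]]]]]]]]].
exists (p, (c, d), q) => //; apply/flatten_mapP; exists (p1, c, q1).
  by rewrite mem_filter /= eqxx.
by apply/mapP; exists (p2, d, q2) => //; rewrite mem_filter /= eqxx.
Qed.

Lemma path_labels_restrict M (A : finType) (G : graph (A * A)) (H : graph A) :
  path_labels M (restrict_graph G H) =
  [set z | [/\ path_labels M G z, path_labels M H (fun i => (z i).1)
             & path_labels M H (fun i => (z i).2)]].
Proof.
rewrite eqEsubset; split=> z.
  case=> r rP; pose s i := odflt (0, 0, 0) (unpickle (r i)).
  have sP i : [/\ ((s i).1.1, z i, (s (i + 1)%R).1.1) \in G,
      ((s i).1.2, (z i).1, (s (i + 1)%R).1.2) \in H &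
      ((s i).2, (z i).2, (s (i + 1)%R).2) \in H].
    have /mem_restrict_graph[p [q [p1 [q1 [p2 [q2 [c [d]]]]]]]] := rP i.
    by case=> -[rE zE rE'] ? ? ?; rewrite /s rE rE' zE !pickleK.
  by split; [exists (fun i => (s i).1.1) | exists (fun i => (s i).1.2)
            | exists (fun i => (s i).2)] => i; have [] := sP i.
case=> [[r rP] [r1 rP1] [r2 rP2]]; exists (fun i => pickle (r i, r1 i, r2 i)) => i.
apply/mem_restrict_graph; exists (r i), (r (i + 1)%R), (r1 i), (r1 (i + 1)%R).
exists (r2 i), (r2 (i + 1)%R), (z i).1, (z i).2; split=> //.
  by rewrite -surjective_pairing.
by rewrite -surjective_pairing.
Qed.

(** The configurations over [nat] that list the letters of the elements of [Y]
    in the order of their positions. *)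
Definition one_sided (M : time) (A : choiceType) (Y : set (config M A)) :
    set (config nat A) :=
  [set z | Y (fun i => z (rank i))].

Lemma mem_fold_graph (A : eqType) (G : graph A) e :
  reflect (exists p q s c,
     (e = (pickle (p, s, false), c, pickle (q, s, true)) \/
      e = (pickle (s, q, true), c, pickle (s, p, false))) /\
     ((p, c, q) \in G /\ s \in vertices G))
  (e \in fold_graph G).
Proof.
rewrite mem_cat; apply: (iffP orP).
  case=> /flatten_mapP[[[p c] q] Ge /mapP[s Vs ->]].
    by exists p, q, s, c; split; [left |].
  by exists p, q, s, c; split; [right |].
move=> [p [q [s [c [[]-> [Ge Vs]]]]]]; [left | right]; apply/flatten_mapP;
  by exists (p, c, q) => //; apply/mapP; exists s.
Qed.

Lemma buchi_language_all (A : finType) (a : automaton A) :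
  (forall p c q, (p, c, q) \in transitions a -> p \in final a) ->
  buchi_language a = [set x | exists2 r : nat -> nat, r 0 \in initial a &
    forall i, (r i, x i, r i.+1) \in transitions a].
Proof.
move=> aP; rewrite eqEsubset; split=> x [r]; first by case=> ? ? _; exists r.
move=> r0 rP; exists r; split=> // n; exists n => //.
exact: aP (rP n).
Qed.

(* The successor in the two time monoids, in normal form. *)
Lemma succ_nat (i : TimeN) : (i + 1)%R = i.+1.
Proof. exact: addn1. Qed.

Lemma succ_Posz n : ((Posz n : TimeZ) + 1)%R = Posz n.+1.
Proof. by change ((Posz n + 1)%R = Posz n.+1); rewrite -addn1 PoszD. Qed.

Lemma succ_Negz n : ((Negz n : TimeZ) + 1)%R = (- Posz n)%R.
Proof.
change ((Negz n + 1)%R = (- Posz n)%R).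
by rewrite NegzE -addn1 PoszD opprD addrNK.
Qed.

Lemma buchi_language_buchi M (A : finType) (G : graph A) :
  buchi_language (buchi M G) = one_sided (path_labels M G).
Proof.
rewrite buchi_language_all; last by case: M => p c q /mem_vertices[].
case: M => [|]; rewrite eqEsubset; split=> x.
- by move=> [r _ rP]; exists r => i; rewrite succ_nat; apply: rP.
- move=> [r rP]; have rP' i : (r i, x i, r i.+1) \in G.
    by have := rP i; rewrite succ_nat.
  by exists r => //; have [] := mem_vertices (rP' 0).
- case=> r /mapP[p0 Vp0 r0] rP.
  pose s i := odflt (0, 0, false) (unpickle (r i)).
  have s0 : s 0 = (p0, p0, false) by rewrite /s r0 pickleK.
  have even_step n : (s n).2 = false ->
      [/\ ((s n).1.1, x n, (s n.+1).1.1) \in G, (s n.+1).1.2 = (s n).1.2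
        & (s n.+1).2].
    have /mem_fold_graph[p [q [t [c [[][rE xE rE'] [Ge Vt]]]]]] := rP n;
    by rewrite /s rE rE' xE !pickleK.
  have odd_step n : (s n).2 ->
      [/\ ((s n.+1).1.2, x n, (s n).1.2) \in G, (s n.+1).1.1 = (s n).1.1
        & (s n.+1).2 = false].
    have /mem_fold_graph[p [q [t [c [[][rE xE rE'] [Ge Vt]]]]]] := rP n;
    by rewrite /s rE rE' xE !pickleK.
  have s_even n : (s n.*2).2 = false.
    elim: n => [|n /even_step[_ _ /odd_step[_ _]]] //; by rewrite s0.
  (* At time [2n] the run has read the positions from [-n] to [n-1] and stores
     the vertices at both ends of this interval. *)
  pose R (i : int) :=
    match i with Posz n => (s n.*2).1.1 | Negz n => (s n.+1.*2).1.2 end.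
  exists R => -[n|n].
    rewrite succ_Posz /=.
    have [e1 e2 odd_s] := even_step _ (s_even n).
    by have [_ e3 _] := odd_step _ odd_s; rewrite doubleS e3.
  have [_ e2 odd_s] := even_step _ (s_even n).
  have [e1 _ _] := odd_step _ odd_s.
  rewrite succ_Negz.
  suff -> : R (- Posz n)%R = (s n.*2).1.2 by rewrite -e2 /= doubleS.
  by case: n {e1 e2 odd_s} => [|n] //=; rewrite s0.
case=> R RP.
pose r n := pickle (R (Posz (uphalf n)), R (- Posz n./2)%R, odd n).
have V i : R i \in vertices G by have [] := mem_vertices (RP i).
exists r; first by apply/mapP; exists (R 0%R); rewrite // /r /= oppr0.
move=> n; apply/mem_fold_graph; have := odd_double_half n; case: odd => nE.
  exists (R (Negz n./2)), (R (- Posz n./2)%R), (R (Posz n./2.+1)), (x n); split.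
    right; rewrite /r -nE add1n /= uphalf_double odd_double /= doubleK.
    by rewrite NegzE.
  split=> //; have := RP (Negz n./2).
  by rewrite succ_Negz /= -add1n nE.
exists (R (Posz n./2)), (R (Posz n./2.+1)), (R (- Posz n./2)%R), (x n); split.
  by left; rewrite /r -nE add0n /= uphalf_double odd_double /= doubleK.
split=> //; have := RP (Posz n./2).
by rewrite succ_Posz /= -[_.*2]add0n nE.
Qed.

(** * Sofic shifts are presented by finite graphs *)

(** Curtis-Hedlund-Lyndon: by compactness, the letter at the origin of the image
    under a continuous map depends on finitely many letters only. *)
Lemma local_rule M (A B : finType) (X : set (config M B))
    (phi : config M B -> config M A) :
  closed X -> {within X, continuous phi} ->
  exists n, forall x x', X x -> X x' -> agree n x x' -> phi x 0%R = phi x' 0%R.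
Proof.
move=> Xc phi_cont; apply: contrapT => /forallNP no_n.
have /choice[u uP] n : exists xx : config M B * config M B,
    [/\ X xx.1, X xx.2, agree n xx.1 xx.2 & phi xx.1 0%R <> phi xx.2 0%R].
  apply: contrapT => /forallNP no_xx; apply: (no_n n) => x x' Xx Xx' xx'.
  by apply: contrapT => neq; apply: (no_xx (x, x')).
(* A limit of pairs that refute longer and longer windows is a pair of equal
   points, at which [phi] cannot be continuous. *)
have [g gP] : exists g, forall n, exists2 m, n <= m & forall i, i < n ->
    ((u m).1 (position M i) : B, (u m).2 (position M i) : B) = g i.
  apply: (@seq_compact _ (enum [set: B * B]%SET)) => m i.
  by rewrite mem_enum inE.
pose x : config M B := fun i => (g (rank i)).1.
have near n : exists2 m, n <= m & agree n x (u m).1 /\ agree n x (u m).2.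
  have [m le_nm mP] := gP n; have [_ _ um _] := uP m; exists m => //.
  have xm k : k < n -> x (position M k) = (u m).1 (position M k).
    by move=> lt_kn; rewrite /x positionK -mP.
  by split=> // k lt_kn; rewrite -um ?xm //; apply: leq_trans le_nm.
have Xx : X x.
  apply: (proj1 (closed_agree X) Xc) => n; have [m _ [xm _]] := near n.
  by exists (u m).1 => //; have [] := uP m.
have : nbhs (phi x) [set z | agree (rank (0 : M)%R).+1 (phi x) z].
  by apply/nbhs_agree; exists (rank (0 : M)%R).+1.
move=> /(proj1 (subspace_continuousP X phi) phi_cont x Xx) /nbhs_agree[n nP].
have [m le_nm [xm1 xm2]] := near n; have [Xm1 Xm2 _] := uP m; apply.
have /agree_position <- // := nP _ xm1 Xm1.
by have /agree_position <- // := nP _ xm2 Xm2.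
Qed.

(** The vertices are the words of length [L + 1] of the SFT, long enough for the
    local rule and for all the forbidden words; an edge joins overlapping words
    and is labelled by the local rule. *)
Lemma sofic_path_labels M (A : finType) (Y : set (config M A)) :
  sofic Y -> exists G : graph A, path_labels M G = Y.
Proof.
move=> [_ [B [X [phi [[[Xc Xs] [F XF]] phi_cont phi_shift YE]]]]].
have [n nP] := local_rule Xc phi_cont.
have [o [o' [N [o'o oN]]]] := position_interval M n.
pose L := maxn N (\max_(w <- F) size w).
pose win (x : config M B) : seq B := word_at x o L.+1.
pose edge (e : nat * A * nat) := exists x x', [/\ X x, X x',
  e = (pickle (win x), phi x 0%R, pickle (win x')) &
  forall k, k < L -> x (o + k.+1%:R)%R = x' (o + k%:R)%R].
have [G GP] : exists G : graph A, forall e, e \in G <-> edge e.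
  pose code (w : L.+1.-tuple B) := pickle (val w).
  pose all_edges : graph A :=
    [seq (code t.1.1, t.1.2, code t.2) | t : L.+1.-tuple B * A * L.+1.-tuple B].
  exists [seq e <- all_edges | `[< edge e >]] => e; rewrite mem_filter.
  split=> [/andP[/asboolP]//|eP]; apply/andP; split; first exact/asboolP.
  have [x [x' [_ _ -> _]]] := eP.
  have win_tuple (z : config M B) : exists w, pickle (win z) = code w.
    by exists (Tuple (introT eqP (size_mkseq (fun i => z (o + i%:R)%R) L.+1))).
  have [w ->] := win_tuple x; have [w' ->] := win_tuple x'.
  by apply/mapP; exists (w, phi x 0%R, w'); rewrite ?mem_enum.
have winP x x' j : win x = win x' -> j <= L -> x (o + j%:R)%R = x' (o + j%:R)%R.
  move=> xx' le_jL; have := congr1 (fun w => nth (x (o + j%:R)%R) w j) xx'.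
  by rewrite !nth_mkseq.
exists G; rewrite YE eqEsubset; split=> y.
  case=> r rP.
  have /choice[xi /all_and2[Xxi /choice[xi' xiP]]] i : exists x, X x /\ exists x',
      [/\ r i = pickle (win x), y i = phi x 0%R, r (i + 1)%R = pickle (win x') &
        forall k, k < L -> x (o + k.+1%:R)%R = x' (o + k%:R)%R].
    have /GP[x [x' [Xx _ [-> -> ->] xx']]] := rP i.
    by exists x; split=> //; exists x'.
  have xi_step i k : k < L -> xi i (o + k.+1%:R)%R = xi (i + 1)%R (o + k%:R)%R.
    have [_ _ ri xx'] := xiP i; have [ri' _ _ _] := xiP (i + 1)%R.
    move=> lt_kL; rewrite xx' //; apply: winP (ltnW lt_kL).
    by apply: (pcan_inj pickleK); rewrite -ri ri'.
  have xi_win i j : j <= L -> xi i (o + j%:R)%R = xi (i + j%:R)%R o.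
    elim: j i => [|j IHj] i lt_jL; first by rewrite !addr0.
    by rewrite xi_step // IHj 1?ltnW // -addrA nat1r.
  (* Each window on the path determines the letter of [x] at its first position. *)
  pose x : config M B := fun j => xi (o' + j)%R o.
  have x_win m j : j <= L -> x (m + j%:R)%R = xi (o' + m)%R (o + j%:R)%R.
    by move=> le_jL; rewrite xi_win // /x addrA.
  have Xx : X x.
    rewrite XF => m l; apply/negP => F_w.
    have le_l : l <= L.
      rewrite leq_max; apply/orP; right.
      by rewrite -(size_mkseq (fun i => x (m + i%:R)%R) l) leq_bigmax_seq.
    have := Xxi (o' + m)%R; rewrite {1}XF => /(_ o l)/negP; apply.
    suff <- : word_at x m l = word_at (xi (o' + m)%R) o l by [].
    apply: (@eq_in_map _ _ _ _ _).1 => j; rewrite mem_iota => lt_jl.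
    by rewrite x_win // (leq_trans (ltnW _) le_l).
  exists x => //; apply/funext => i; have [_ -> _ _] := xiP i.
  rewrite -[i in LHS]addr0 -[LHS]/(translate i (phi x) 0%R) -phi_shift //.
  apply: nP => //; first exact: Xs.
  move=> k /oN[j lt_jN ->]; rewrite /translate addrA x_win ?addrA.
    by rewrite [(o' + i)%R]addrC -[(_ + o' + o)%R]addrA o'o addr0.
  by rewrite (leq_trans (ltnW lt_jN)) // leq_maxl.
case=> x Xx <-; exists (fun i => pickle (win (translate i x))) => i.
apply/GP; exists (translate i x), (translate (i + 1)%R x); split.
- exact: Xs.
- exact: Xs.
- by rewrite phi_shift // /translate addr0.
move=> k _; rewrite /translate -nat1r -!addrA; congr (x _); congr (_ + _)%R.
by rewrite addrCA.
Qed.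

(** * Homeomorphic quotients *)

Local Open Scope quotient_scope.

Lemma homeomorphism_comp (T U V : topologicalType) (h : U -> V) (k : T -> U) :
  homeomorphism h -> homeomorphism k -> homeomorphism (h \o k).
Proof.
move=> [hc [h' [h'c hK h'K]]] [kc [k' [k'c kK k'K]]]; split.
  by move=> x; apply: continuous_comp; [exact: kc | exact: hc].
exists (k' \o h'); split; last 2 first.
- exact: can_comp.
- exact: can_comp.
by move=> x; apply: continuous_comp; [exact: h'c | exact: k'c].
Qed.

Lemma class_of_eq (T : topologicalType) (R : rel T) (E : equivalence R) x y :
  class_of E x = class_of E y <-> R x y.
Proof.
have RE : quotient_rel E x y = R x y by rewrite /quotient_rel; case: E.
rewrite -RE; split=> [xy|xy]; last exact/eqmodP.
by apply/eqmodP.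
Qed.

Lemma class_of_repr (T : topologicalType) (R : rel T) (E : equivalence R)
    (q : quotient_space E) : class_of E (repr q) = q.
Proof. exact: reprK. Qed.

Lemma class_of_continuous (T : topologicalType) (R : rel T) (E : equivalence R) :
  continuous (class_of E).
Proof. exact: pi_continuous. Qed.

(** A continuous map compatible with the relations descends to the quotients. *)
Lemma quotient_map_continuous (T U : topologicalType) (R : rel T) (S : rel U)
    (E : equivalence R) (E' : equivalence S) (f : T -> U) :
  continuous f -> (forall x y, R x y -> S (f x) (f y)) ->
  continuous (fun q : quotient_space E => class_of E' (f (repr q))) /\
  forall x, class_of E' (f (repr (class_of E x))) = class_of E' (f x).
Proof.
move=> fc fRS.
have kE x : class_of E' (f (repr (class_of E x))) = class_of E' (f x).
  by apply/class_of_eq/fRS/class_of_eq; rewrite class_of_repr.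
split=> //; apply/quotient_continuous.
have -> : (fun q : quotient_space E => class_of E' (f (repr q)))
    \o \pi_(quotient_space E) = class_of E' \o f.
  by apply/funext => x; apply: kE.
by move=> x; apply: continuous_comp; [exact: fc | exact: class_of_continuous].
Qed.

(** A homeomorphism that transports one relation to another induces a
    homeomorphism of the quotients. *)
Lemma quotient_homeomorphism (T U : topologicalType) (R : rel T) (S : rel U)
    (E : equivalence R) (f : T -> U) (g : U -> T) :
  continuous f -> continuous g -> cancel f g -> cancel g f ->
  (forall u v, S u v = R (g u) (g v)) ->
  exists (E' : equivalence S) (k : quotient_space E' -> quotient_space E),
    homeomorphism k.
Proof.
move=> fc gc fK gK SE; have [Rr Rs Rt] := E.
have E' : equivalence S.
  split=> [u|u v|v u w]; rewrite !SE; [exact: Rr | exact: Rs | exact: Rt].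
have fRS x y : R x y -> S (f x) (f y) by rewrite SE !fK.
have gSR u v : S u v -> R (g u) (g v) by rewrite SE.
have [kc kE] := quotient_map_continuous E' E gc gSR.
have [lc lE] := quotient_map_continuous E E' fc fRS.
exists E', (fun q => class_of E (g (repr q))); split=> //.
exists (fun q => class_of E' (f (repr q))); split=> //= q.
  by rewrite lE gK class_of_repr.
by rewrite kE fK class_of_repr.
Qed.

(** * Passing from two-sided to one-sided configurations *)

Lemma continuous_agree M M' (A B : choiceType) (f : config M A -> config M' B) :
  (forall n, exists m, forall x y, agree m x y -> agree n (f x) (f y)) ->
  continuous f.
Proof.
move=> fP x U /nbhs_agree[n nU]; have [m mP] := fP n.
by apply/nbhs_agree; exists m => y /mP/nU.
Qed.

Lemma set_type_continuous (T U : topologicalType) (Y : set T) (Y' : set U)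
    (f : T -> U) (g : set_type Y -> set_type Y') :
  continuous f -> (forall y, val (g y) = f (val y)) -> continuous g.
Proof.
move=> fc gE; apply: continuous_comp_initial.
have -> : set_val \o g = f \o set_val by apply/funext => y; apply: gE.
move=> y; apply: continuous_comp; last exact: fc.
exact: initial_continuous.
Qed.

Section OneSided.
Context (M : time) {A : choiceType}.
Implicit Type Y : set (config M A).

(** The homeomorphism between configurations over [M] and over the natural
    numbers that lists the positions outwards from the origin, and its inverse. *)
Definition to_nat (x : config M A) : config TimeN A := fun n => x (position M n).
Definition of_nat (z : config TimeN A) : config M A := fun i => z (rank i).

Lemma to_natK : cancel to_nat of_nat.
Proof. by move=> x; apply/funext => i; rewrite /of_nat /to_nat rankK. Qed.

Lemma of_natK : cancel of_nat to_nat.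
Proof. by move=> x; apply/funext => i; rewrite /of_nat /to_nat positionK. Qed.

Lemma to_nat_continuous : continuous to_nat.
Proof. by apply: continuous_agree => n; exists n => x y xy k /xy. Qed.

Lemma of_nat_continuous : continuous of_nat.
Proof.
apply: continuous_agree => n; exists n => x y xy k /xy.
by rewrite /of_nat positionK.
Qed.

Lemma one_sided_to_nat Y x : Y x -> (one_sided Y : set (config TimeN A)) (to_nat x).
Proof.
by move=> Yx; rewrite /one_sided /= -[fun i => _]/(of_nat (to_nat x)) to_natK.
Qed.

End OneSided.

Arguments of_nat M {A} z.

(** If [Y] and [Z] are presented by graphs, then the automata of the graphs read
    outwards present the quotient. *)
Lemma closed_quotient_of_graphs M (X : dynamical_system M) (A : finType)
    (Y : set (config M A)) (Z : set (config M (A * A)%type))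
    (H : graph A) (G : graph (A * A)) :
  path_labels M H = Y -> path_labels M G = Z -> conjugate_to_sofic_quotient X Y Z ->
  homeomorphic_to_closed_quotient X (buchi_language (buchi M H))
    (buchi_language (buchi M (restrict_graph G H))).
Proof.
move=> HY GZ [_ [[Zc _] _] [E [h [hh _]]]].
rewrite !buchi_language_buchi path_labels_restrict HY GZ.
set W := [set z | _]; pose Y' : set (config TimeN A) := one_sided Y.
pose W' : set (config TimeN (A * A)%type) := one_sided W.
have Zc' : closed (one_sided Z : set (config TimeN (A * A)%type)).
  apply/closed_agree => z zZ; apply: (proj1 (closed_agree Z) Zc) => n.
  have [z' Zz' zz'] := zZ n; exists (of_nat M z') => // k lt_kn.
  by rewrite /of_nat positionK; apply: zz'.
have relE (y y' : set_type Y') :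
    pair_rel Y' W' y y' = `[< one_sided Z (pairing (val y) (val y')) >].
  apply/asboolP/asboolP => [[]//|Zyy']; split=> //.
    exact: (set_mem (valP y)).
  exact: (set_mem (valP y')).
split.
- by move=> x y [].
- pose p (yy : set_type Y' * set_type Y') : config TimeN (A * A)%type :=
    pairing (val yy.1) (val yy.2).
  have pc : continuous p.
    move=> yy U /(@nbhs_agree TimeN)[n nU].
    pose V (y : set_type Y') : set (set_type Y') :=
      set_val @^-1` [set x | agree n (val y : config TimeN A) x].
    have V_nbhs y : nbhs y (V y).
      by apply: initial_continuous; apply/(@nbhs_agree TimeN); exists n.
    exists (V yy.1, V yy.2) => [|[y y'] [/= Vy Vy']]; first by split; apply: V_nbhs.
    apply: nU => k lt_kn; rewrite /p /pairing.
    by congr pair; [apply: Vy | apply: Vy'].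
  have -> : [set yy : set_type Y' * set_type Y' | pair_rel Y' W' yy.1 yy.2] =
      p @^-1` (one_sided Z : set (config TimeN (A * A)%type)).
    by apply/seteqP; split=> yy /=; rewrite relE => /asboolP.
  exact: (proj1 (continuous_closedP p) pc).
pose f (y : set_type Y) : set_type Y' :=
  exist _ (to_nat (val y)) (mem_set (one_sided_to_nat (set_mem (valP y)))).
pose g (y : set_type Y') : set_type Y :=
  exist _ (of_nat M (val y)) (mem_set (set_mem (valP y) : Y (of_nat M (val y)))).
have fc : continuous f by apply: (set_type_continuous (@to_nat_continuous M A)).
have gc : continuous g by apply: (set_type_continuous (@of_nat_continuous M A)).
have fK : cancel f g by move=> y; apply: val_inj; apply: to_natK.
have gK : cancel g f by move=> y; apply: val_inj; apply: of_natK.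
have SE u v : pair_rel Y' W' u v = pair_rel Y Z (g u) (g v) by rewrite relE.
have [E' [k kh]] := quotient_homeomorphism E fc gc fK gK SE.
by exists E', (h \o k); apply: homeomorphism_comp.
Qed.

Theorem theorem8p2 (M : time) :
  (forall X : dynamical_system M, sofically_presented X -> automatic X) /\
  (exists f : presentation -> presentation,
     computable f /\
     forall (X : dynamical_system M) (p : presentation),
       sofic_presentation X p -> automatic_presentation X (f p)).
Proof.
split.
  move=> X [A [Y [Z XYZ]]]; have [Ys Zs _] := XYZ.
  have [H HY] := sofic_path_labels Ys; have [G GZ] := sofic_path_labels Zs.
  exists A, (buchi_language (buchi M H)).
  exists (buchi_language (buchi M (restrict_graph G H))).
  split; [by exists (buchi M H) | by exists (buchi M (restrict_graph G H)) |].
  exact: closed_quotient_of_graphs HY GZ XYZ.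
exists (automatic_of M); split; first exact: computable_automatic_of.
move=> X [k [a b]] [Y [Z [/= aY bZ XYZ]]].
have [[Ysub _] [Zsub _] _] := XYZ.
apply: closed_quotient_of_graphs XYZ; exact: path_labels_trim.
Qed.
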